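(* Let $m,n$ be positive integers and $\sigma>0$. For any positive real number $\gamma$, $$C_G(m,n,\sigma^2)\;\ge\; n-m\gamma\log_2(\sqrt e)-\log_2\left(\sum_{k=0}^{n}\binom nk\left(\sum_{j=0}^{k}\frac{\binom kj}{2^k}\,\frac{e^{-2\left(\frac{2j-k}{\sigma\sqrt m}\right)^2\left(\frac{\gamma}{1+\gamma}\right)}}{\sqrt{1+\gamma}}\right)^m\right),$$ where $C_G(m,n,\sigma^2)$ is the maximal sum capacity of binary CDMA channels with $n$ users, spreading gain $m$ and additive i.i.d. centered Gaussian noise of variance $\sigma^2$.
   Context: Let $\mathcal M_{m\times n}(\pm1)$ be the set of $m\times n$ matrices with entries in $\{+1,-1\}$. For $A\in\mathcal M_{m\times n}(\pm1)$ the channel has input $X=(X_1,\dots,X_n)^T\in\{\pm1\}^n$ and output $Y=\frac1{\sqrt m}AX+N$, where $N=(N_1,\dots,N_m)^T$ has i.i.d. $\mathcal N(0,\sigma^2)$ entries and is independent of $X$. Its sum capacity $C(A)$ is $\max I(X;Y)$, where $I$ is mutual information in bits (base-2 logarithms) and the maximum is over all product distributions of $X$ on $\{\pm1\}^n$ (i.e. $X_1,\dots,X_n$ independent). Define $C_G(m,n,\sigma^2)=\max_{A\in\mathcal M_{m\times n}(\pm1)}C(A)$. *)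

(* Defs.v *)
From HB Require Import structures.
From mathcomp Require Import all_boot all_order all_algebra.
From mathcomp Require Import all_classical all_reals all_analysis.
From mathcomp Require Import measurable_realfun.

Set Implicit Arguments.
Unset Strict Implicit.
Unset Printing Implicit Defensive.

Import Order.TTheory GRing.Theory Num.Theory.
Import numFieldNormedType.Exports.

Local Open Scope classical_set_scope.
Local Open Scope ring_scope.

Definition log2 (R : realType) (x : R) : R := ln x / ln 2.

Section product_prob.
Context d (T : measurableType d) (R : realType).
Local Open Scope ereal_scope.

Definition tuple_cons n (x : T * n.-tuple T) : n.+1.-tuple T :=
  [tuple of x.1 :: x.2].

Let measurable_tuple_cons n : measurable_fun setT (@tuple_cons n).
Proof. exact: measurable_cons. Qed.

HB.instance Definition _ n :=
  isMeasurableFun.Build _ _ _ _ (@tuple_cons n) (@measurable_tuple_cons n).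

(* The joint law of independent Z_0, ..., Z_(n-1), where Z_i has law P i;
   product_probE checks it on measurable boxes, which determine it. *)
Fixpoint product_prob n : ('I_n -> probability T R) ->
    probability (n.-tuple T) R :=
  match n with
  | 0 => fun=> \d_([tuple] : 0.-tuple T)
  | n'.+1 => fun P =>
      distribution (P ord0 \x product_prob (fun i => P (lift ord0 i)))
                   (@tuple_cons n')
  end.

Lemma product_probE n (P : 'I_n -> probability T R) (A : 'I_n -> set T) :
  (forall i, measurable (A i)) ->
  product_prob P [set t | forall i, A i (tnth t i)] = \prod_(i < n) P i (A i).
Proof.
elim: n P A => [|n IHn] P A mA.
  by rewrite big_ord0 /= diracE mem_set// => -[].
rewrite big_ord_recl -IHn => [|i]; last exact: mA.
have mB k (B : 'I_k -> set T) : (forall i, measurable (B i)) ->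
    measurable [set t : k.-tuple T | forall i, B i (tnth t i)].
  move=> mB.
  rewrite (_ : [set t | _] =
      \bigcap_(i in [set: 'I_k]) ((@tnth _ T ^~ i) @^-1` B i)).
    apply: fin_bigcap_measurable => [|i _]; first exact: finite_finset.
    by rewrite -[X in measurable X]setTI; exact: (measurable_tnth i).
  by apply/seteqP; split=> t /= h i => [_|]; exact: h.
rewrite -product_measure1E; [|exact: mA|exact: (mB _ (fun i => A (lift ord0 i)))].
rewrite /= /distribution /pushforward; congr (_ _).
apply/seteqP; split=> -[x t] /= h.
  split=> [|i]; first by have := h ord0.
  by have := h (lift ord0 i); rewrite /tuple_cons tnthS.
move=> i; have [j ->|->] := unliftP ord0 i; last exact: h.1.
by rewrite /tuple_cons tnthS; exact: h.2.
Qed.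

End product_prob.

Section mutual_information.
Local Open Scope ereal_scope.
Local Open Scope charge_scope.

(* Relative entropy in bits. The junk value of log2 at 0 is harmless: the
   derivative is positive outside a P-negligible set. *)
Definition kl_div d (T : measurableType d) (R : realType)
    (P Q : probability T R) : \bar R :=
  if `[< P `<< Q >]
  then \int[P]_x (log2 (fine (('d (charge_of_finite_measure P) '/d Q) x)))%:E
  else +oo.

Section pair_rv.
Context d d1 d2 (T : measurableType d) (T1 : measurableType d1)
  (T2 : measurableType d2).

Definition pair_rv (X : {mfun T >-> T1}) (Y : {mfun T >-> T2}) (w : T) :
  T1 * T2 := (X w, Y w).

Variables (X : {mfun T >-> T1}) (Y : {mfun T >-> T2}).

Let measurable_pair_rv : measurable_fun setT (pair_rv X Y).
Proof. exact: measurable_fun_pair. Qed.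

HB.instance Definition _ :=
  isMeasurableFun.Build _ _ _ _ (pair_rv X Y) measurable_pair_rv.
End pair_rv.

Definition mutual_info d d1 d2 (T : measurableType d) (T1 : measurableType d1)
    (T2 : measurableType d2) (R : realType) (P : probability T R)
    (X : {RV P >-> T1}) (Y : {RV P >-> T2}) : \bar R :=
  kl_div (distribution P (pair_rv X Y)) (distribution P X \x distribution P Y).

End mutual_information.
Arguments mutual_info {d d1 d2 T T1 T2 R} P X Y.


Section gaussian_noise.
Variable R : realType.

(* normal_prob lives on measurableTypeR R, whose measurable structure is that
   of R under another display: idTR transports it to R. *)
Definition idTR : measurableTypeR R -> R := idfun.

Let measurable_idTR : measurable_fun setT idTR.
Proof. by move=> _ A mA; rewrite setTI. Qed.

HB.instance Definition _ :=
  isMeasurableFun.Build _ _ _ _ idTR measurable_idTR.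

(* sigma is the standard deviation. *)
Definition gaussian_noise (sigma : R) : probability R R :=
  distribution (normal_prob 0 sigma) idTR.

End gaussian_noise.

Section cdma_channel.
Context (R : realType) (m n : nat).
Implicit Types (A : 'M[R]_(m, n)) (sigma : R) (Q : 'I_n -> probability R R).

(* The sample space consists of the pairs (input, noise). *)
Definition channel_input (w : n.-tuple R * m.-tuple R) : n.-tuple R := w.1.

Definition channel_output A (w : n.-tuple R * m.-tuple R) : m.-tuple R :=
  [tuple (Num.sqrt m%:R)^-1 * (A *m \col_j tnth w.1 j) i ord0 + tnth w.2 i
    | i < m].

Let measurable_channel_input : measurable_fun setT channel_input.
Proof. exact: measurable_fst. Qed.

HB.instance Definition _ :=
  isMeasurableFun.Build _ _ _ _ channel_input measurable_channel_input.

Let measurable_channel_output A : measurable_fun setT (channel_output A).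
Proof.
apply/measurable_fun_tnthP => i.
rewrite (_ : _ \o _ = fun w => (Num.sqrt m%:R)^-1 *
    (\sum_(j < n) A i j * tnth w.1 j) + tnth w.2 i); last first.
  apply/funext => w /=; rewrite tnth_mktuple mxE; congr (_ * _ + _).
  by apply: eq_bigr => j _; rewrite mxE.
apply: measurable_funD; last first.
  exact: (measurableT_comp (measurable_tnth i) measurable_snd).
apply: measurable_funM; first exact: measurable_cst.
apply: measurable_sum => j; apply: measurable_funM; first exact: measurable_cst.
exact: (measurableT_comp (measurable_tnth j) measurable_fst).
Qed.

HB.instance Definition _ A :=
  isMeasurableFun.Build _ _ _ _ (channel_output A)
    (measurable_channel_output A).

Definition channel_prob sigma Q :
    probability (n.-tuple R * m.-tuple R)%type R :=
  (product_prob Q \x product_prob (fun _ : 'I_m => gaussian_noise sigma))%E.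

Definition pm1_dist Q : Prop := forall i, Q i [set 1; -1] = 1%E.

Definition pm1_mx A : Prop := forall i j, A i j = 1 \/ A i j = -1.

(* The maximum over input distributions is written as a supremum in \bar R
   (it is attained, by compactness and continuity); the one over matrices
   ranges over a finite nonempty set, so there too supremum and maximum
   coincide. *)
Definition sum_capacity A sigma : \bar R :=
  ereal_sup [set mutual_info (channel_prob sigma Q)
                   channel_input (channel_output A) | Q in pm1_dist].

Definition max_sum_capacity sigma : \bar R :=
  ereal_sup [set sum_capacity A sigma | A in pm1_mx].

End cdma_channel.

(* Main.v *)
(* The Donsker-Varadhan inequality KL(P || Q) >= E_P g - ln E_Q e^g (in nats)
   is applied with P the joint law of (X, Y) for uniform X, Q the product of
   its marginals, and g(x, y) = - gamma |y - A x / sqrt m|^2 / (2 sigma^2).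
   Under P, y - A x / sqrt m is the noise, so E_P g = - m gamma / 2. Under Q,
   the input x' that produced y is independent of x, and E_Q e^g averages over
   x, x' a product of m Gaussian integrals. The average of E_Q e^g over all
   sign matrices A depends on x, x' only through the number k of positions in
   which they differ; it is 2^-n times the sum in the theorem, and some A does
   at least as well as the average. *)
Require Import Defs.
From HB Require Import structures.
From mathcomp Require Import all_boot all_order all_algebra.
From mathcomp Require Import all_classical all_reals all_analysis.
From mathcomp Require Import measurable_realfun.
From mathcomp Require Import ring lra.

Set Implicit Arguments.
Unset Strict Implicit.
Unset Printing Implicit Defensive.

Import Order.TTheory GRing.Theory Num.Theory.
Import numFieldNormedType.Exports.

Local Open Scope classical_set_scope.
Local Open Scope ring_scope.

(** * Lower bound on relative entropy by a change of measure *)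

(** The positive part of [f] lies below that of [g], and the negative part of [g] below that of [f].
    The lemma is meant for [g] a log-density, whose integral may be infinite. *)
Lemma integrable_ae_le_integral d (T : measurableType d) (R : realType)
    (mu : {measure set T -> \bar R}) (f g : T -> \bar R) :
  mu.-integrable setT f -> measurable_fun setT g ->
  {ae mu, forall x, (f x <= g x)%E} ->
  (\int[mu]_x f x <= \int[mu]_x g x)%E.
Proof.
move=> intf mg fg; have mf := measurable_int _ intf.
rewrite integralE [leRHS]integralE; apply: leeB.
  apply: ae_ge0_le_integral => //; [exact: measurable_funepos..|].
  by apply: filterS fg => x fg _; rewrite !funeposE ge_max !le_max fg lexx orbT.
apply: ae_ge0_le_integral => //; [exact: measurable_funeneg..|].
apply: filterS fg => x fg _.
by rewrite !funenegE ge_max !le_max leeN2 fg lexx orbT.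
Qed.

Section donsker_varadhan.
Context d (T : measurableType d) (R : realType).
Variables (P Q : probability T R) (q : T -> R) (a Z : R).
Hypotheses (mq : measurable_fun setT q) (q0 : forall x, 0 <= q x) (Z0 : 0 < Z).
Hypothesis qa : (\int[P]_x (q x)%:E <= a%:E)%E.
Hypothesis qZ : (\int[Q]_x (expR (- q x))%:E <= Z%:E)%E.

(** If [r] is the density of [P] and [u = e^-q / (Z r)], then [e^t >= 1 + t] at [t = ln u] gives
    [ln r >= - q + (1 - ln Z) - u]. Integration against [P] concludes, since [u] has mean at most 1.
    Without domination the divergence is [+oo]. *)
Lemma donsker_varadhan : (((- a - ln Z) / ln 2)%:E <= kl_div P Q)%E.
Proof.
rewrite /kl_div; case: asboolP => [PQ|_]; last by rewrite leey.
pose f := Radon_Nikodym_SigmaFinite.f P Q.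
pose r x : R := fine (f x).
have fE x : f x = (r x)%:E.
  by rewrite fineK// Radon_Nikodym_SigmaFinite.f_fin_num.
have r0 x : 0 <= r x by rewrite fine_ge0// Radon_Nikodym_SigmaFinite.f_ge0.
have mf : measurable_fun setT f.
  exact: measurable_int (Radon_Nikodym_SigmaFinite.f_integrable PQ).
have mr : measurable_fun setT r by exact: measurableT_comp.
(* The derivative in [kl_div] agrees with the pointwise finite version [f] only up to a [Q]-null
   set, which is also [P]-null by domination. *)
have fRN : {ae P, forall x,
    f x = Radon_Nikodym (charge_of_finite_measure P) Q x}.
  have [N [mN N0 subN]] :=
    ae_eq_Radon_Nikodym_SigmaFinite PQ (measurableT : measurable [set: T]).
  exists N; split => //.
    exact: (null_content_dominatesP _ _).1 PQ _ mN N0.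
  by move=> x /= nfx; apply: subN => /= /(_ I).
(* u = e^-q / (Z r) wherever r > 0; where r = 0, the junk value ln 0 = 0 is
   harmless because only r u matters there. *)
pose u x := expR (- q x - ln Z - ln (r x)).
have u0 x : 0 <= u x by exact: expR_ge0.
have mexpq : measurable_fun setT (fun x => expR (- q x)).
  by apply: measurableT_comp => //; exact: measurableT_comp.
have mu : measurable_fun setT u.
  apply: measurableT_comp => //; apply: measurable_funB; last first.
    exact: measurableT_comp.
  by apply: measurable_funB => //; exact: measurableT_comp.
have intu : (\int[P]_x (u x)%:E <= 1)%E.
  (* The mean of [u] under [P] is that of [u r] under [Q], and [u r <= e^-q / Z] pointwise. *)
  rewrite -(Radon_Nikodym_SigmaFinite.change_of_variables PQ)//; last first.
    exact/measurable_EFinP.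
  apply: (@le_trans _ _ (\int[Q]_x (Z^-1%:E * (expR (- q x))%:E))%E);
      last first.
    rewrite ge0_integralZl ?lee_fin ?invr_ge0 ?(ltW Z0)//; last first.
      exact/measurable_EFinP.
    rewrite -lee_pdivlMl ?invr_gt0// invrK -EFinM mulr1//.
  apply: ge0_le_integral => //.
  - by move=> x _; rewrite -/f fE -EFinM lee_fin mulr_ge0.
  - by apply: emeasurable_funM => //; exact/measurable_EFinP.
  - by apply/measurable_EFinP; exact: measurable_funM.
  - move=> x _; rewrite -/f fE -!EFinM lee_fin /u.
    have [->|rx0] := eqVneq (r x) 0.
      by rewrite mulr0 mulr_ge0 ?invr_ge0 ?expR_ge0 ?ltW.
    have rx : 0 < r x by rewrite lt0r rx0 r0.
    by rewrite !expRD !expRN !lnK ?posrE// mulfVK// mulrC.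
have intPq : P.-integrable setT (EFin \o q).
  apply/integrableP; split; first exact/measurable_EFinP.
  under eq_integral do rewrite /= ger0_norm//.
  by rewrite (le_lt_trans qa)// ltry.
have intPu : P.-integrable setT (EFin \o u).
  apply/integrableP; split; first exact/measurable_EFinP.
  under eq_integral do rewrite /= ger0_norm//.
  by rewrite (le_lt_trans intu)// ltry.
have intPc : P.-integrable setT (EFin \o cst (1 - ln Z)).
  by apply: finite_measure_integrable_cst.
pose G := (fun x => (ln 2)^-1%:E * ((- (q x)%:E + (1 - ln Z)%:E) - (u x)%:E))%E.
have intG : P.-integrable setT
    (fun x => (- (q x)%:E + (1 - ln Z)%:E) - (u x)%:E)%E.
  by apply: integrableB => //; apply: integrableD => //; exact: integrableN.
have ln2 : 0 < ln 2 :> R by rewrite ln_gt0// ltr1n.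
(* Apart from the factor [1 / ln 2], the mean of [G] is at least [- a + (1 - ln Z) - 1], where the
   two units cancel. *)
apply: (@le_trans _ _ (\int[P]_x G x)%E).
  rewrite integralZl// integralB//; last first.
    by apply: integrableD => //; exact: integrableN.
  rewrite integralD//; last exact: integrableN.
  rewrite integral_ge0N; last by move=> x _; rewrite lee_fin.
  have -> : (\int[P]_x (1 - ln Z)%:E = (1 - ln Z)%:E)%E.
    rewrite (integral_cst P measurableT) -[RHS]mule1; congr (_ * _)%E.
    exact: probability_setT.
  have /fineK <- : (\int[P]_x (q x)%:E)%E \is a fin_num.
    exact: integrable_fin_num.
  move: qa; rewrite -(fineK (integrable_fin_num _ intPq))// lee_fin => qa'.
  have /fineK : (\int[P]_x (u x)%:E)%E \is a fin_num.
    exact: integrable_fin_num.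
  move=> uE; move: intu; rewrite -uE lee_fin => u1.
  rewrite -!EFinN -!EFinD -EFinM lee_fin mulrC.
  rewrite ler_wpM2l ?invr_ge0 ?(ltW ln2)//.
  move: qa' u1; rewrite /=; lra.
apply: integrable_ae_le_integral; first exact: integrableZl.
  apply/measurable_EFinP; apply: measurable_funM => //.
  apply: measurableT_comp => //; apply: measurableT_comp => //.
apply: filterS fRN => x fx.
rewrite -fx fE /= /log2 /G -!EFinN -!EFinD -EFinM lee_fin mulrC.
rewrite ler_wpM2r ?invr_ge0 ?(ltW ln2)//.
have := expR_ge1Dx (- q x - ln Z - ln (r x)); rewrite -/(u x).
lra.
Qed.

End donsker_varadhan.

(** * Gaussian integrals in one variable *)

Section gaussian_integrals.
Variables (R : realType) (s : R).
Hypothesis s0 : 0 < s.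
Local Notation leb := (@lebesgue_measure R).

(** The Radon-Nikodym derivative of the normal law and [normal_pdf] have equal integrals over all
    measurable sets, so they agree almost everywhere. *)
Lemma ge0_integral_gaussian_noise (f : R -> \bar R) :
    measurable_fun setT f -> (forall x, 0 <= f x)%E ->
  (\int[gaussian_noise s]_x f x =
   \int[leb]_x (f x * (normal_pdf 0 s x)%:E))%E.
Proof.
move=> mf f0; rewrite ge0_integral_distribution//.
have dom := @normal_prob_dominates R 0 s.
rewrite -(Radon_Nikodym_SigmaFinite.change_of_variables dom)//.
apply: ge0_ae_eq_integral => //.
- apply: emeasurable_funM => //.
  exact: measurable_int (Radon_Nikodym_SigmaFinite.f_integrable dom).
- apply: emeasurable_funM => //.
  exact: measurable_int (integrable_normal_pdf 0 s).
- move=> x _; apply: mule_ge0 => //.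
  exact: Radon_Nikodym_SigmaFinite.f_ge0.
- by move=> x _; apply: mule_ge0 => //; rewrite lee_fin normal_pdf_ge0.
- apply: ae_eqe_mul2l; apply: integral_ae_eq => //.
  + exact: Radon_Nikodym_SigmaFinite.f_integrable.
  + exact: measurable_int (integrable_normal_pdf 0 s).
  + move=> A _ mA; rewrite -Radon_Nikodym_SigmaFinite.f_integral//.
Qed.

(** Completing the square, [t (x + d)^2 + x^2 = (1 + t) (x + t d / (1 + t))^2 + t d^2 / (1 + t)]:
    the integrand times the density is a constant times the normal density of mean [- t d / (1 + t)]
    and variance [s^2 / (1 + t)]. *)
Lemma integral_gaussian_noise_expR (t d : R) : 0 <= t ->
  (\int[gaussian_noise s]_x (expR (- t * (x + d) ^+ 2 / (2 * s ^+ 2)))%:E =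
   (expR (- (t / (1 + t)) * d ^+ 2 / (2 * s ^+ 2)) / Num.sqrt (1 + t))%:E)%E.
Proof.
move=> t0; have t1 : 0 < 1 + t by rewrite ltr_pwDl.
have q0 : 0 < Num.sqrt (1 + t) by rewrite sqrtr_gt0.
rewrite ge0_integral_gaussian_noise; last 2 first.
- apply/measurable_EFinP; apply: measurableT_comp => //.
  apply: measurable_funM => //; apply: measurable_funM => //.
  by apply: measurable_funX; exact: measurable_funD.
- by move=> x; rewrite lee_fin expR_ge0.
pose s' := s / Num.sqrt (1 + t).
have s'0 : 0 < s' by rewrite divr_gt0.
set c := (X in _ = (X)%:E).
transitivity
  (\int[leb]_x (c%:E * (normal_pdf (- (t / (1 + t)) * d) s' x)%:E))%E.
  apply: eq_integral => x _; rewrite -!EFinM; congr EFin.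
  rewrite !normal_pdfE ?gt_eqF// /normal_peak /normal_fun /c.
  have -> : s ^+ 2 * pi *+ 2 = (s' ^+ 2 * pi *+ 2) * (1 + t).
    rewrite /s' expr_div_n sqr_sqrtr ?(ltW t1)//.
    by field; rewrite gt_eqF.
  rewrite sqrtrM; last first.
    by rewrite mulrn_wge0// mulr_ge0 ?sqr_ge0// pi_ge0.
  rewrite [(Num.sqrt _ * _)^-1]invfM mulrCA -expRD.
  rewrite [expR _ / _]mulrC [RHS]mulrACA -expRD.
  rewrite [_^-1 / _]mulrC; congr (_ * expR _).
  rewrite /s' expr_div_n sqr_sqrtr ?(ltW t1)//.
  by field; rewrite !gt_eqF.
rewrite integralZl//; last exact: integrable_normal_pdf.
by rewrite integral_normal_pdf mule1.
Qed.

(* Fatou: z is the limit of k (1 - e^(-z / k)), whose Gaussian mean is given by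
   integral_gaussian_noise_expR. *)
Lemma gaussian_noise_sqr_le :
  (\int[gaussian_noise s]_x (x ^+ 2 / (2 * s ^+ 2))%:E <= (2^-1)%:E)%E.
Proof.
pose z (x : R) := x ^+ 2 / (2 * s ^+ 2).
have z0 x : 0 <= z x.
  by apply: divr_ge0; [exact: sqr_ge0|apply: mulr_ge0 => //; exact: sqr_ge0].
have mz : measurable_fun setT z.
  apply: measurable_funM => //; exact: measurable_funX.
pose f n x := ((n.+1%:R * (1 - expR (- (n.+1%:R^-1 * z x))))%:E : \bar R).
have mf n : measurable_fun setT (f n).
  apply/measurable_EFinP; apply: measurable_funM => //.
  apply: measurable_funB => //; apply: measurableT_comp => //.
  apply: measurableT_comp => //; exact: measurable_funM.
have f0 n x : (0 <= f n x)%E.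
  rewrite lee_fin mulr_ge0// subr_ge0 -expR0 ler_expR.
  by rewrite oppr_le0 mulr_ge0.
have fz x : limn_einf (f ^~ x) = (z x)%:E.
  apply: (cvg_limn_einf_sup _).1; apply: cvg_EFin; first exact: nearW.
  (* With [k = n + 1] and [y = z / k], the upper bound is [1 - y <= e^-y]. The lower one comes from
     [e^-y <= 1 / (1 + y) <= 1 - y + y^2], the last step because
     [(1 + y) (1 - y + y^2) = 1 + y^3]. *)
  apply: (@squeeze_cvgr _ _ _ _ (fun n => z x - z x ^+ 2 * harmonic n)
    (cst (z x))); last 2 first.
  - rewrite -[X in _ --> X]subr0 -(mulr0 (z x ^+ 2)).
    by apply: cvgB; [exact: cvg_cst|apply: cvgMr; exact: cvg_harmonic].
  - exact: cvg_cst.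
  apply: nearW => n /=; set k : R := n.+1%:R.
  have k0 : 0 < k by rewrite ltr0n.
  apply/andP; split; last first.
    rewrite -ler_pdivlMl// lerBlDr -lerBlDl.
    exact: expR_ge1Dx.
  have kz : 0 <= k^-1 * z x.
    by apply: mulr_ge0 => //; rewrite invr_ge0 ltW.
  have : expR (- (k^-1 * z x)) <= (1 + k^-1 * z x)^-1.
    rewrite expRN lef_pV2 ?posrE ?expR_gt0 ?expR_ge1Dx//.
    by rewrite ltr_pwDl.
  move=> h.
  have h2 : (1 + k^-1 * z x)^-1 <= 1 - k^-1 * z x + (k^-1 * z x) ^+ 2.
    rewrite -div1r ler_pdivrMr ?ltr_pwDl//.
    rewrite [leRHS](_ : _ = 1 + (k^-1 * z x) ^+ 3); last by ring.
    by rewrite lerDl exprn_ge0.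
  have -> : z x - z x ^+ 2 / k =
      k * (1 - (1 - k^-1 * z x + (k^-1 * z x) ^+ 2)).
    by field; rewrite gt_eqF.
  rewrite ler_wpM2l ?(ltW k0)// lerD2l lerN2; exact: le_trans h h2.
have fE n : (\int[gaussian_noise s]_x f n x <= (2^-1)%:E)%E.
  set k : R := n.+1%:R.
  have k1 : 1 <= k by rewrite ler1n.
  have k0 : 0 < k by rewrite ltr0n.
  have expE : (\int[gaussian_noise s]_x (expR (- (k^-1 * z x)))%:E =
      ((Num.sqrt (1 + k^-1))^-1)%:E)%E.
    have := @integral_gaussian_noise_expR k^-1 0.
    rewrite invr_ge0 (ltW k0) expr0n /= mulr0 mul0r expR0 div1r.
    move=> /(_ isT) <-.
    by apply: eq_integral => x _; rewrite addr0 /z !mulNr mulrA.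
  have int1 : (gaussian_noise s).-integrable setT (EFin \o cst 1).
    exact: finite_measure_integrable_cst.
  have intexp : (gaussian_noise s).-integrable setT
      (EFin \o (fun x => expR (- (k^-1 * z x)))).
    apply/integrableP; split.
      apply/measurable_EFinP; apply: measurableT_comp => //.
      by apply: measurableT_comp => //; exact: measurable_funM.
    under eq_integral do rewrite /= ger0_norm ?expR_ge0//.
    by rewrite expE ltry.
  rewrite /f -/k.
  under eq_integral do rewrite EFinM EFinB.
  rewrite integralZl//; last exact: integrableB.
  rewrite integralB// expE.
  have -> : (\int[gaussian_noise s]__ 1 = 1)%E.
    by rewrite (integral_cst _ measurableT) mul1e; exact: probability_setT.
  rewrite -EFinB -EFinM lee_fin -ler_pdivlMl//.
  have t0 : 0 < k^-1 by rewrite invr_gt0.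
  have t1 : k^-1 <= 1 by rewrite invf_le1.
  move: k^-1 t0 t1 => t t0 t1.
  (* The claim is [1 - t / 2 <= 1 / sqrt (1 + t)]. After squaring it reads [(1 + t) (1 - t / 2)^2 =
     1 - 3 t^2 / 4 + t^3 / 4 <= 1]. *)
  rewrite lerBlDl -lerBlDr -[leLHS]invrK lef_pV2 ?posrE; last 2 first.
  - by rewrite invr_gt0; lra.
  - by rewrite sqrtr_gt0; lra.
  rewrite -ler_sqr ?nnegrE ?sqrtr_ge0 ?invr_ge0//; last by lra.
  rewrite sqr_sqrtr; last by lra.
  rewrite exprVn -[leRHS]div1r ler_pdivlMr; last by rewrite exprn_gt0//; lra.
  nra.
have := fatou (gaussian_noise s) measurableT mf (fun n x _ => f0 n x).
under eq_integral do rewrite fz.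
move/le_trans; apply.
rewrite limn_einf_lim; apply: lime_le; first exact: is_cvg_einfs.
apply: nearW => n; apply: le_trans (fE n); apply: ereal_inf_lbound.
by exists n => /=.
Qed.

End gaussian_integrals.

(** * Integration against product laws *)

Section product_prob_integral.
Context d (T : measurableType d) (R : realType).

Lemma ge0_integral_product_probS n (P : 'I_n.+1 -> probability T R)
    (f : n.+1.-tuple T -> \bar R) :
  measurable_fun setT f -> (forall t, 0 <= f t)%E ->
  (\int[product_prob P]_t f t =
   \int[P ord0]_x \int[product_prob (fun i => P (lift ord0 i))]_t
     f (tuple_cons (x, t)))%E.
Proof.
move=> mf f0; rewrite /= ge0_integral_distribution// fubini_tonelli1//.
- by apply: measurableT_comp => //; exact: measurable_funP.
- by move=> x; exact: f0.
Qed.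

(** Induction on [n], with Tonelli splitting off coordinate 0. Naming the integrals by reals [c i]
    keeps the product out of the extended reals. *)
Lemma integral_product_prob_prod n (P : 'I_n -> probability T R)
    (h : 'I_n -> T -> R) (c : 'I_n -> R) :
  (forall i, measurable_fun setT (h i)) -> (forall i x, 0 <= h i x) ->
  (forall i, \int[P i]_x (h i x)%:E = (c i)%:E)%E ->
  (\int[product_prob P]_t (\prod_(i < n) h i (tnth t i))%:E =
   (\prod_(i < n) c i)%:E)%E.
Proof.
elim: n P h c => [|n IHn] P h c mh h0 hc.
  rewrite /= integral_dirac//; last first.
    by under eq_fun do rewrite big_ord0; exact: measurable_cst.
  by rewrite diracT mul1e !big_ord0.
have mprod k (g : 'I_k -> T -> R) : (forall i, measurable_fun setT (g i)) ->
    measurable_fun setT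
      (fun t : k.-tuple T => (\prod_(i < k) g i (tnth t i))%:E).
  move=> mg; apply/measurable_EFinP; apply: measurable_prod => i _.
  by apply: measurableT_comp => //; exact: measurable_tnth.
rewrite ge0_integral_product_probS; last 2 first.
- exact: mprod.
- by move=> t; rewrite lee_fin prodr_ge0.
transitivity (\int[P ord0]_x ((h ord0 x)%:E *
    (\prod_(i < n) c (lift ord0 i))%:E))%E.
  apply: eq_integral => x _.
  rewrite -(IHn (fun i => P (lift ord0 i)) (fun i => h (lift ord0 i)))//.
  rewrite -ge0_integralZl//; last 3 first.
  - exact: (mprod _ (fun i => h (lift ord0 i))).
  - by move=> t _; rewrite lee_fin prodr_ge0.
  - by rewrite lee_fin.
  apply: eq_integral => t _; rewrite -EFinM big_ord_recl; congr (_ * _)%:E.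
  by apply: eq_bigr => i _; rewrite /tuple_cons tnthS.
rewrite ge0_integralZr//; last 3 first.
- exact/measurable_EFinP.
- by move=> x _; rewrite lee_fin.
- rewrite lee_fin prodr_ge0// => i _; rewrite -lee_fin -hc.
  by apply: integral_ge0 => x _; rewrite lee_fin.
by rewrite hc -EFinM big_ord_recl.
Qed.

Lemma measurable_tuple_box n (A : 'I_n -> set T) :
  (forall i, measurable (A i)) ->
  measurable [set t : n.-tuple T | forall i, A i (tnth t i)].
Proof.
move=> mA; rewrite (_ : [set t | _] =
    \bigcap_(i in [set: 'I_n]) ((@tnth _ T ^~ i) @^-1` A i)).
  apply: fin_bigcap_measurable => [|i _]; first exact: finite_finset.
  by rewrite -[X in measurable X]setTI; exact: (measurable_tnth i).
by apply/seteqP; split=> t /= h i => [_|]; exact: h.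
Qed.

End product_prob_integral.

(** * Uniform sign vectors *)

Section uniform_signs.
Context (R : realType).

Definition sign_of_bool (b : bool) : R := if b then 1 else -1.

Let measurable_sign_of_bool : measurable_fun setT sign_of_bool.
Proof. by []. Qed.

HB.instance Definition _ :=
  isMeasurableFun.Build _ _ _ _ sign_of_bool measurable_sign_of_bool.

Definition uniform_sign : probability R R :=
  distribution (bernoulli_prob 2^-1) sign_of_bool.

Lemma uniform_signE (A : set R) :
  uniform_sign A = ((2^-1)%:E * \d_(1%R : R) A + (2^-1)%:E * \d_((-1)%R : R) A)%E.
Proof.
have h01 : 0 <= (2^-1 : R) <= 1 by rewrite invr_ge0 invf_le1 ?ler1n ?ler0n.
pose p : R := 2^-1.
transitivity (p%:E * \d_true (sign_of_bool @^-1` A) +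
    (1 - p)%:E * \d_false (sign_of_bool @^-1` A))%E.
  exact: bernoulli_probE.
by have -> : 1 - p = p by rewrite /p; lra.
Qed.

(** A sign vector is encoded by the set of its positive positions, so that averages over inputs
    become sums over subsets. *)
Definition signs n (S : {set 'I_n}) : n.-tuple R :=
  [tuple sign_of_bool (i \in S) | i < n].

Lemma sign_of_bool_inj : injective sign_of_bool.
Proof.
have neg : (-1 : R) == 1 = false by apply/eqP; lra.
by move=> [] [] // /eqP; rewrite /sign_of_bool ?neg // eq_sym neg.
Qed.

Lemma signs_inj n : injective (@signs n).
Proof.
move=> S S' SS'; apply/setP => i; apply: sign_of_bool_inj.
by have := congr1 (fun t => tnth t i) SS'; rewrite !tnth_mktuple.
Qed.

(** The law is carried by the [2^n] atoms [signs S], each of mass [2^-n], so [f] agrees almost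
    everywhere with a finite combination of indicators of atoms. *)
Lemma integral_uniform_signs n (f : n.-tuple R -> R) :
  measurable_fun setT f -> (forall t, 0 <= f t) ->
  (\int[product_prob (fun _ : 'I_n => uniform_sign)]_t (f t)%:E =
   (\sum_(S : {set 'I_n}) f (signs S) / 2 ^+ n)%:E)%E.
Proof.
move=> mf f0; set mu := product_prob _.
have set1E (v : n.-tuple R) :
    [set v] = [set t | forall i, [set tnth v i] (tnth t i)].
  apply/seteqP; split => [t -> //|t /= h].
  by apply: eq_from_tnth.
have mset1 (v : n.-tuple R) : measurable [set v].
  by rewrite set1E; apply: (measurable_tuple_box (A := fun i => [set tnth v i])).
have muE S : mu [set signs S] = ((2 ^+ n)^-1)%:E.
  rewrite set1E (product_probE _ (A := fun i => [set tnth (signs S) i]))//.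
  rewrite -exprVn -[in RHS](card_ord n) -prodr_const -prodEFin.
  apply: eq_bigr => i _; rewrite uniform_signE tnth_mktuple !diracE.
  have neg : (-1 : R) <> 1 by lra.
  rewrite /sign_of_bool; case: (i \in S).
    rewrite mem_set// [X in (_ + _ * X%:R%:E)%E](_ : _ = false :> nat).
      by rewrite mule1 mule0 adde0.
    by rewrite memNset.
  rewrite memNset ?mule0 ?add0e; last by move=> /esym/neg.
  by rewrite mem_set// mule1.
pose pm1 (_ : 'I_n) : set R := [set 1; -1].
have mpm1 i : measurable (pm1 i) by exact: measurableU.
(* [E] is the set of all sign vectors. It has full mass, and outside it [g] vanishes while [f] may
   not. *)
pose E := [set t : n.-tuple R | forall i, pm1 i (tnth t i)].
have mE : measurable E.
  exact: measurable_tuple_box.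
have muEC : mu (~` E) = 0%E.
  rewrite probability_setC// product_probE//.
  rewrite big1 ?subee// => i _.
  rewrite uniform_signE !diracE !mem_set; last 2 first.
  - by right.
  - by left.
  by rewrite !mule1 -EFinD; congr EFin; lra.
pose g t :=
  (\sum_(S : {set 'I_n}) ((f (signs S))%:E * (\1_[set signs S] t)%:E))%E.
transitivity (\int[mu]_t g t)%E.
  apply: ge0_ae_eq_integral => //.
  - exact/measurable_EFinP.
  - apply: emeasurable_sum => S; apply: emeasurable_funM => //.
    exact/measurable_EFinP/measurable_indic.
  - by move=> t _; rewrite lee_fin.
  - by move=> t _; apply: sume_ge0 => S _; rewrite mule_ge0 ?lee_fin.
  exists (~` E); split => //; first exact: measurableC.
  move=> t /=; apply: contra_not => Et _; rewrite /g.
  have -> : t = signs [set i | tnth t i == 1].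
    apply: eq_from_tnth => i; rewrite tnth_mktuple inE /sign_of_bool.
    by case: eqP => // ti; case: (Et i).
  set S := (X in signs X); clearbody S; rewrite (bigD1 S)//= big1 ?adde0.
    by rewrite indicE mem_set// mule1.
  move=> S' SS'; rewrite indicE memNset ?mule0//= => /signs_inj.
  by apply/eqP; rewrite eq_sym.
rewrite /g ge0_integral_sum//; last 2 first.
- move=> S; apply: emeasurable_funM => //.
  exact/measurable_EFinP/measurable_indic.
- by move=> S t _; rewrite mule_ge0 ?lee_fin.
rewrite -sumEFin; apply: eq_bigr => S _.
rewrite ge0_integralZl//; last 2 first.
- exact/measurable_EFinP/measurable_indic.
- by rewrite lee_fin.
by rewrite integral_indic// setIT EFinM -(muE S).
Qed.

End uniform_signs.

(** * Sums over subsets and over signs *)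

(** Each subset [U] of [K] is the trace on [K] of exactly [2^(#|T| - #|K|)] sets, namely the
    [U :|: V] with [V] disjoint from [K]. The traces are then counted by size. *)
Lemma sum_set_cardI (M : nmodType) (T : finType) (K : {set T}) (G : nat -> M) :
  \sum_(S : {set T}) G #|S :&: K| =
  (\sum_(0 <= i < #|K|.+1) G i *+ 'C(#|K|, i)) *+ 2 ^ (#|T| - #|K|).
Proof.
rewrite (partition_big (fun S => S :&: K) (mem (powerset K)))/=; last first.
  by move=> S _; rewrite powersetE finset.subsetIr.
transitivity (\sum_(U in powerset K) G #|U| *+ 2 ^ (#|T| - #|K|)).
  apply: eq_bigr => U; rewrite powersetE => UK.
  rewrite (eq_bigr (fun=> G #|U|)); last by move=> S /eqP ->.
  rewrite (eq_bigl (fun S => S \in finset (fun S => S :&: K == U))); last first.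
    by move=> S; rewrite finset.in_set.
  rewrite sumr_const; congr (_ *+ _).
  rewrite (_ : (_ - _)%N = #|~: K|); last by rewrite [RHS]cardsCs finset.setCK.
  rewrite -card_powerset -[RHS](card_in_imset (f := fun V => U :|: V)).
    apply: eq_card => S; rewrite inE; apply/eqP/imsetP => [SU|[V]].
      exists (S :\: K); first by rewrite powersetE finset.subsetDr.
      by rewrite -SU finset.setID.
    rewrite powersetE => VK ->.
    rewrite finset.setIUl (finset.setIidPl UK).
    rewrite (finset.disjoint_setI0 _) ?finset.setU0//.
    by rewrite finset.disjoints_subset.
  have E (W : {set T}) : W \subset ~: K -> (U :|: W) :\: K = W.
    move=> WK; rewrite finset.setDUl.
    have /eqP -> : U :\: K == finset.set0 by rewrite finset.setD_eq0.
    rewrite finset.set0U; apply/finset.setDidPl.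
    by rewrite finset.disjoints_subset.
  by move=> V V'; rewrite !powersetE => /E {2}<- /E {2}<- ->.
rewrite [LHS]sumrMnl; congr (_ *+ _).
rewrite big_mkord.
rewrite (partition_big (fun U : {set T} => inord #|U| : 'I_#|K|.+1) xpredT)//=.
apply: eq_bigr => i _.
have cardE (U : {set T}) : U \in powerset K -> (inord #|U| == i) = (#|U| == i).
  rewrite powersetE => UK.
  by rewrite -val_eqE /= inordK// ltnS subset_leq_card.
rewrite (eq_bigr (fun=> G i)); last first.
  by move=> U /andP[UK]; rewrite cardE// => /eqP ->.
rewrite sumr_const -cards_draws; congr (_ *+ _); apply: eq_card => U.
rewrite inE unfold_in; case: (boolP (U \in powerset K)) => UK /=.
  by rewrite -powersetE UK cardE.
by rewrite -powersetE (negbTE UK).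
Qed.

Section sign_sums.
Variables (R : realType) (n : nat).
Implicit Types (A B C K : {set 'I_n}).
Local Notation sg := (@sign_of_bool R).

Definition symdiff B C : {set 'I_n} := [set j | (j \in B) (+) (j \in C)].

Lemma symdiffK B : involutive (symdiff B).
Proof. by move=> C; apply/setP => j; rewrite !inE addKb. Qed.

(** Symmetric difference with a fixed [B] permutes the subsets, so only their sizes have to be
    counted. *)
Lemma sum_symdiff (G : nat -> R) B :
  \sum_(C : {set 'I_n}) G #|symdiff B C| =
  \sum_(0 <= k < n.+1) 'C(n, k)%:R * G k.
Proof.
rewrite (reindex_inj (inv_inj (symdiffK B)))/=.
transitivity (\sum_(C : {set 'I_n}) G #|C :&: [set: 'I_n]|).
  by apply: eq_bigr => C _; rewrite symdiffK finset.setIT.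
rewrite sum_set_cardI cardsT card_ord subnn mulr1n.
by apply: eq_bigr => k _; rewrite mulr_natl.
Qed.

(** In probabilistic terms, the product of a uniform sign row with the difference of two sign
    vectors is twice a sum of [#|symdiff B C|] independent signs, of which [i] are positive. *)
Lemma sum_sign_mul (h : R -> R) B C :
  \sum_(A : {set 'I_n})
     h (\sum_j sg (j \in A) * (sg (j \in B) - sg (j \in C))) =
  2 ^+ n * \sum_(0 <= i < #|symdiff B C|.+1)
     'C(#|symdiff B C|, i)%:R / 2 ^+ #|symdiff B C| *
     h (2 * (2 * i%:R - #|symdiff B C|%:R)).
Proof.
set K := symdiff B C.
(* Multiplying the signs A by those of B replaces sB - sC by 1 - sB sC, which is
   2 on K and 0 elsewhere. *)
rewrite (reindex_inj (inv_inj (symdiffK (~: B))))/=.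
transitivity (\sum_(A : {set 'I_n}) h (2 * (2 * #|A :&: K|%:R - #|K|%:R))).
  apply: eq_bigr => A _; congr h.
  transitivity (\sum_(j in K) (2 * (2 * (j \in A)%:R - 1) : R)).
    rewrite [RHS]big_mkcond/=; apply: eq_bigr => j _; rewrite !inE /sign_of_bool.
    by case: (j \in A); case: (j \in B); case: (j \in C) => /=; ring.
  rewrite -mulr_sumr sumrB -mulr_sumr sumr_const; congr (2 * (2 * _ - _)).
  rewrite -sum1_card natr_sum [LHS]big_mkcond [RHS]big_mkcond/=.
  apply: eq_bigr => j _; rewrite finset.in_setI andbC.
  by case: (j \in K); case: (j \in A).
rewrite (sum_set_cardI K (fun i => h (2 * (2 * i%:R - #|K|%:R)))) card_ord.
rewrite -[LHS]mulr_natl natrX mulr_sumr [RHS]mulr_sumr.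
apply: eq_bigr => i _; rewrite -[_ *+ 'C(_, _)]mulr_natl.
have Kn : (#|K| <= n)%N by rewrite -[leqRHS]card_ord max_card.
have -> : 2 ^+ n = 2 ^+ (n - #|K|) * 2 ^+ #|K| :> R by rewrite -exprD subnK.
field.
by rewrite expf_neq0// pnatr_eq0.
Qed.

End sign_sums.

(** * Averaging, and single coordinates of product laws *)

(** If every value exceeded [Z], so would the mean; [i0] witnesses that [I] is nonempty, which makes
    the inequality strict. *)
Lemma exists_le_of_sum_le (R : realDomainType) (I : finType) (i0 : I)
    (W : I -> R) (Z : R) : \sum_i W i <= #|I|%:R * Z -> exists i, W i <= Z.
Proof.
move=> WZ; apply: contrapT => /forallNP Wgt.
suff : #|I|%:R * Z < \sum_i W i by rewrite ltNge WZ.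
rewrite mulr_natl -sumr_const; apply: ltr_sum.
  by apply/hasP; exists i0; rewrite // mem_index_enum.
by move=> i _; rewrite ltNge; apply/negP/Wgt.
Qed.
Lemma sumr_fin_gt0 (R : realDomainType) (I : finType) (i0 : I) (W : I -> R) :
  (forall i, 0 < W i) -> 0 < \sum_i W i.
Proof.
move=> W0; rewrite ltNge; apply/negP => W_le0.
have [|i] := @exists_le_of_sum_le R I i0 W 0; first by rewrite mulr0.
by rewrite leNgt W0.
Qed.

(** Product formula with factor [h] at position [i] and 1 elsewhere. *)
Lemma integral_product_prob_coord d (T : measurableType d) (R : realType) n
    (P : 'I_n -> probability T R) (i : 'I_n) (h : T -> R) (c : R) :
  measurable_fun setT h -> (forall x, 0 <= h x) ->
  (\int[P i]_x (h x)%:E = c%:E)%E ->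
  (\int[product_prob P]_t (h (tnth t i))%:E = c%:E)%E.
Proof.
move=> mh h0 hc.
have := @integral_product_prob_prod _ _ _ _ P
  (fun j => if j == i then h else cst 1) (fun j => if j == i then c else 1).
rewrite -big_mkcond big_pred1_eq => <- => [|j|j x|j].
- apply: eq_integral => t _; congr EFin; rewrite (bigD1 i)//= eqxx big1 ?mulr1//.
  by move=> j /negbTE ->.
- by case: eqP.
- by case: eqP.
- case: eqP => [->//|_]; transitivity (\int[P j]_x cst 1%E x)%E => //.
  by rewrite (integral_cst (P j) measurableT) mul1e; exact: probability_setT.
Qed.

Section integral_prod_coord.
Context d1 d2 (T1 : measurableType d1) (T2 : measurableType d2) (R : realType).
Variables (P1 : probability T1 R) (P2 : probability T2 R).

Lemma ge0_integral_prod_fst (f : T1 -> \bar R) :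
  measurable_fun setT f -> (forall x, 0 <= f x)%E ->
  (\int[P1 \x P2]_z f z.1 = \int[P1]_x f x)%E.
Proof.
move=> mf f0; rewrite (fubini_tonelli1 (fun z => f z.1))//; last first.
  exact: measurableT_comp.
apply: eq_integral => x _; rewrite /fubini_F /= (integral_cst P2 measurableT).
by rewrite -[RHS]mule1; congr (_ * _)%E; exact: probability_setT.
Qed.

Lemma ge0_integral_prod_snd (f : T2 -> \bar R) :
  measurable_fun setT f -> (forall x, 0 <= f x)%E ->
  (\int[P1 \x P2]_z f z.2 = \int[P2]_x f x)%E.
Proof.
move=> mf f0; rewrite (fubini_tonelli2 (fun z => f z.2))//; last first.
  exact: measurableT_comp.
apply: eq_integral => x _; rewrite /fubini_G /= (integral_cst P1 measurableT).
by rewrite -[RHS]mule1; congr (_ * _)%E; exact: probability_setT.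
Qed.

End integral_prod_coord.

(** * The capacity of a fixed matrix under uniform inputs *)

Section channel_bounds.
Variables (R : realType) (m n : nat) (sigma gamma : R).
Hypotheses (hsigma : 0 < sigma) (hgamma : 0 < gamma).
Variable A : 'M[R]_(m, n).

Local Notation Q := (fun _ : 'I_n => uniform_sign R).
Local Notation noise := (product_prob (fun _ : 'I_m => gaussian_noise sigma)).

Definition noiseless_output (i : 'I_m) (x : n.-tuple R) : R :=
  (Num.sqrt m%:R)^-1 * (\sum_j A i j * tnth x j).

Let measurable_noiseless_output i : measurable_fun setT (noiseless_output i).
Proof.
apply: measurable_funM => //; apply: measurable_sum => j.
by apply: measurable_funM => //; exact: measurable_tnth.
Qed.

Let channel_outputE w i : tnth (channel_output A w) i =
  noiseless_output i w.1 + tnth w.2 i.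
Proof.
rewrite tnth_mktuple /noiseless_output mxE; congr (_ * _ + _).
by apply: eq_bigr => j _; rewrite mxE.
Qed.

(** This is [- g] for the test function [g] of Donsker-Varadhan. It takes arbitrary pairs (input,
    output), so that it can be integrated under both the joint law and the product of its
    marginals. *)
Definition residual_energy (z : n.-tuple R * m.-tuple R) : R :=
  \sum_i gamma * ((tnth z.2 i - noiseless_output i z.1) ^+ 2 / (2 * sigma ^+ 2)).

Let measurable_residual_energy : measurable_fun setT residual_energy.
Proof.
apply: measurable_sum => i; apply: measurable_funM => //.
apply: measurable_funM => //; apply: measurable_funX.
apply: measurable_funB.
  exact: (measurableT_comp (measurable_tnth i) measurable_snd).
exact: (measurableT_comp (measurable_noiseless_output i) measurable_fst).
Qed.

Let two_sigma2_gt0 : 0 < 2 * sigma ^+ 2.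
Proof. by rewrite mulr_gt0// exprn_gt0. Qed.

Let residual_energy_ge0 z : 0 <= residual_energy z.
Proof.
apply: sumr_ge0 => i _; apply: mulr_ge0; first exact: ltW.
by apply: divr_ge0; [exact: sqr_ge0|exact: ltW].
Qed.

Lemma integral_residual_energy_joint_le :
  (\int[distribution (channel_prob m sigma Q)
          (pair_rv (@channel_input R m n) (channel_output A))]_z
      (residual_energy z)%:E <= (m%:R * (gamma / 2))%:E)%E.
Proof.
rewrite ge0_integral_distribution//; last first.
  exact/measurable_EFinP.
pose e (t : R) := t ^+ 2 / (2 * sigma ^+ 2).
have e0 t : 0 <= e t by apply: divr_ge0; [exact: sqr_ge0|exact: ltW].
have me : measurable_fun setT e.
  by apply: measurable_funM => //; exact: measurable_funX.
have mFi (i : 'I_m) :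
    measurable_fun setT (fun t : m.-tuple R => (gamma * e (tnth t i))%:E).
  apply/measurable_EFinP; apply: measurable_funM => //.
  by apply: measurableT_comp => //; exact: measurable_tnth.
have F0i (i : 'I_m) (t : m.-tuple R) : (0 <= (gamma * e (tnth t i))%:E)%E.
  by rewrite lee_fin mulr_ge0// ltW.
pose F (t : m.-tuple R) := (\sum_(i < m) (gamma * e (tnth t i))%:E)%E.
apply: (@le_trans _ _ (\int[noise]_t F t)%E).
  rewrite -[leRHS](ge0_integral_prod_snd (product_prob Q)); last 2 first.
  - by rewrite /F; apply: emeasurable_sum => i; exact: mFi.
  - by move=> t; rewrite /F; apply: sume_ge0 => i _; exact: F0i.
  (* The two sides are equal: subtracting the noiseless output from the channel output leaves the
     noise. *)
  rewrite le_eqVlt; apply/orP; left; apply/eqP.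
  apply: eq_integral => w _; rewrite /F sumEFin /residual_energy /=.
  congr EFin; apply: eq_bigr => i _.
  by rewrite channel_outputE /channel_input addrC addKr.
rewrite ge0_integral_sum//.
rewrite -[m in m%:R](card_ord m) mulr_natl -sumr_const -sumEFin.
apply: lee_sum => i _.
have eE : (\int[gaussian_noise sigma]_x (e x)%:E <= (2^-1)%:E)%E.
  exact: gaussian_noise_sqr_le.
(* Finiteness allows the second moment to serve as the real constant [c] of
   [integral_product_prob_coord]. *)
have /fineK efin : (\int[gaussian_noise sigma]_x (e x)%:E)%E \is a fin_num.
  rewrite ge0_fin_numE ?(le_lt_trans eE) ?ltry//.
  by apply: integral_ge0 => x _; rewrite lee_fin.
under eq_integral do rewrite EFinM.
rewrite ge0_integralZl//; last 3 first.
- apply/measurable_EFinP.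
  by apply: measurableT_comp => //; exact: measurable_tnth.
- by move=> t _; rewrite lee_fin.
- by rewrite lee_fin ltW.
rewrite (integral_product_prob_coord (P := fun=> gaussian_noise sigma)
  (i := i) me e0 (esym efin)).
by rewrite efin EFinM lee_pmul2l// ?lte_fin// lte_fin.
Qed.

(** The mean of [exp (- gamma (N + d)^2 / (2 sigma^2))] for a noise coordinate [N], as computed in
    [integral_gaussian_noise_expR]. *)
Definition gaussian_factor (d : R) : R :=
  expR (- (gamma / (1 + gamma)) * d ^+ 2 / (2 * sigma ^+ 2)) /
  Num.sqrt (1 + gamma).

Let measurable_gaussian_factor : measurable_fun setT gaussian_factor.
Proof.
apply: measurable_funM => //; apply: measurableT_comp => //.
by apply: measurable_funM => //; exact: measurable_funM.
Qed.

Let gaussian_factor_ge0 d : 0 <= gaussian_factor d.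
Proof. by rewrite divr_ge0 ?expR_ge0 ?sqrtr_ge0. Qed.

(** When [x'] is sent and [x] is tested, the residual in coordinate [i] is the noise shifted by the
    difference of the noiseless outputs; independence of the coordinates gives the product. *)
Lemma integral_residual_energy_noise (x x' : n.-tuple R) :
  (\int[noise]_t (expR (- residual_energy (x, channel_output A (x', t))))%:E =
   (\prod_i gaussian_factor (noiseless_output i x' - noiseless_output i x))%:E)%E.
Proof.
pose h (i : 'I_m) t := expR (- gamma *
  (t + (noiseless_output i x' - noiseless_output i x)) ^+ 2 / (2 * sigma ^+ 2)).
rewrite -(integral_product_prob_prod (P := fun=> gaussian_noise sigma) (h := h)).
- apply: eq_integral => t _; rewrite /h -expR_sum; congr (expR _)%:E.
  rewrite /residual_energy -sumrN; apply: eq_bigr => i _.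
  rewrite channel_outputE /=.
  rewrite -mulrA mulNr; congr (- (_ * (_ ^+ 2 / _))); ring.
- move=> i; apply: measurableT_comp => //.
  apply: measurable_funM => //; apply: measurable_funM => //.
  by apply: measurable_funX; exact: measurable_funD.
- by move=> i t; exact: expR_ge0.
- by move=> i; rewrite integral_gaussian_noise_expR// ltW.
Qed.

(** Here [B] encodes the tested input and [C] the independent input that produced the output. *)
Definition mean_exp_residual_energy : R :=
  \sum_(B : {set 'I_n}) (\sum_(C : {set 'I_n})
    (\prod_i gaussian_factor (noiseless_output i (signs R C) -
       noiseless_output i (signs R B))) / 2 ^+ n) / 2 ^+ n.

(** Tonelli puts the tested input outside. The output law is then pulled back to pairs (sent input,
    noise), and a second use of Tonelli integrates the noise first. *)
Lemma integral_exp_residual_energy_indep :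
  (\int[distribution (channel_prob m sigma Q) (@channel_input R m n) \x
        distribution (channel_prob m sigma Q) (channel_output A)]_z
      (expR (- residual_energy z))%:E = mean_exp_residual_energy%:E)%E.
Proof.
have mexp : measurable_fun setT (fun z => (expR (- residual_energy z))%:E).
  apply/measurable_EFinP; apply: measurableT_comp => //.
  exact: measurableT_comp.
have exp0 z : (0 <= (expR (- residual_energy z))%:E)%E.
  by rewrite lee_fin expR_ge0.
rewrite fubini_tonelli1//.
rewrite ge0_integral_distribution; last 2 first.
- exact: measurable_fun_fubini_tonelli_F.
- by move=> x; apply: integral_ge0.
rewrite (ge0_integral_prod_fst _ _ (f := fubini_F _ _)); last 2 first.
- exact: measurable_fun_fubini_tonelli_F.
- by move=> x; apply: integral_ge0.
pose G (x' x : n.-tuple R) :=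
  \prod_i gaussian_factor (noiseless_output i x' - noiseless_output i x).
have G0 x' x : 0 <= G x' x by exact: prodr_ge0.
have mG1 x : measurable_fun setT (G ^~ x).
  apply: measurable_prod => i _; apply: measurableT_comp => //.
  exact: measurable_funB.
have mG2 x' : measurable_fun setT (G x').
  apply: measurable_prod => i _; apply: measurableT_comp => //.
  exact: measurable_funB.
transitivity (\int[product_prob Q]_x
    (\sum_(C : {set 'I_n}) G (signs R C) x / 2 ^+ n)%:E)%E; last first.
  rewrite integral_uniform_signs//.
    by apply: measurable_sum => C; apply: measurable_funM => //; exact: mG2.
  by move=> x; apply: sumr_ge0 => C _; rewrite divr_ge0// exprn_ge0.
apply: eq_integral => x _.
have mexpx :
    measurable_fun setT (fun y => (expR (- residual_energy (x, y)))%:E).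
  exact: (measurableT_comp mexp (pair1_measurable x)).
rewrite /fubini_F ge0_integral_distribution//.
rewrite -(integral_uniform_signs (mG1 x) (G0 ^~ x)).
rewrite fubini_tonelli1; last 2 first.
- by apply: (measurableT_comp mexpx); exact: measurable_funP.
- by move=> w; exact: exp0.
by apply: eq_integral => x' _; exact: integral_residual_energy_noise.
Qed.

Lemma mean_exp_residual_energy_gt0 : 0 < mean_exp_residual_energy.
Proof.
have p0 : 0 < (2 ^+ n : R) by rewrite exprn_gt0.
have f0 d : 0 < gaussian_factor d.
  by rewrite divr_gt0 ?expR_gt0// sqrtr_gt0 addr_gt0.
apply: (sumr_fin_gt0 finset.set0) => B; rewrite divr_gt0//.
apply: (sumr_fin_gt0 finset.set0) => C; rewrite divr_gt0//.
by apply: prodr_gt0.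
Qed.

(** The uniform input is one of the laws in the supremum, and [donsker_varadhan] applies to it with
    [a = m gamma / 2]. *)
Lemma sum_capacity_ge (Z : R) : mean_exp_residual_energy <= Z ->
  (((- (m%:R * (gamma / 2)) - ln Z) / ln 2)%:E <= sum_capacity A sigma)%E.
Proof.
move=> WZ; have Z0 := lt_le_trans mean_exp_residual_energy_gt0 WZ.
apply: (@le_trans _ _ (mutual_info (channel_prob m sigma Q)
    (@channel_input R m n) (channel_output A))).
  apply: (@donsker_varadhan _ _ _ _ _ residual_energy) => //.
    exact: integral_residual_energy_joint_le.
  by rewrite integral_exp_residual_energy_indep lee_fin.
apply: ereal_sup_ubound; exists Q => //.
move=> i; rewrite uniform_signE !diracE !mem_set; last 2 first.
- by right.
- by left.
by rewrite !mule1 -EFinD; congr EFin; lra.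
Qed.

End channel_bounds.

(** * Averaging over all sign matrices *)

Section averaging.
Variables (R : realType) (m n : nat) (sigma gamma : R).

(** A matrix is given by a function from rows to subsets, the index type over which a product of row
    sums expands. *)
Definition sign_mx (a : {ffun 'I_m -> {set 'I_n}}) : 'M[R]_(m, n) :=
  \matrix_(i, j) sign_of_bool R (j \in a i).

Lemma pm1_sign_mx a : pm1_mx (sign_mx a).
Proof. by move=> i j; rewrite mxE /sign_of_bool; case: ifP; [left|right]. Qed.

(** For fixed inputs the sum over matrices of a product over rows is the [m]-th power of a single
    row sum. By [sum_sign_mul] this depends only on the number of positions where the inputs differ,
    and [sum_symdiff] counts the pairs. *)
Lemma sum_mean_exp_residual_energy :
  \sum_a mean_exp_residual_energy sigma gamma (sign_mx a) =
  #|{ffun 'I_m -> {set 'I_n}}|%:R * ((\sum_(0 <= k < n.+1) 'C(n, k)%:R *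
    (\sum_(0 <= i < k.+1) 'C(k, i)%:R / 2 ^+ k *
      gaussian_factor sigma gamma
        ((Num.sqrt m%:R)^-1 * (2 * (2 * i%:R - k%:R)))) ^+ m) / 2 ^+ n).
Proof.
pose h u := gaussian_factor sigma gamma ((Num.sqrt m%:R)^-1 * u).
pose T k := \sum_(0 <= i < k.+1)
  'C(k, i)%:R / 2 ^+ k * h (2 * (2 * i%:R - k%:R)).
rewrite -/h; set S := \sum_(0 <= k < n.+1) _.
have p0 : (2 ^+ n : R) != 0 by rewrite expf_neq0// pnatr_eq0.
have prodE (B C : {set 'I_n}) :
  \sum_a \prod_i gaussian_factor sigma gamma
     (noiseless_output (sign_mx a) i (signs R C) -
      noiseless_output (sign_mx a) i (signs R B)) =
  (2 ^+ n * T #|symdiff C B|) ^+ m.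
  rewrite /T -sum_sign_mul -[in RHS](card_ord m) -prodr_const.
  rewrite bigA_distr_bigA/=; apply: eq_bigr => a _; apply: eq_bigr => i _.
  rewrite /h /noiseless_output -mulrBr -sumrB.
  congr (gaussian_factor _ _ (_ * _)).
  by apply: eq_bigr => j _; rewrite !tnth_mktuple mxE mulrBr.
transitivity (\sum_(C : {set 'I_n}) \sum_(B : {set 'I_n})
    (2 ^+ n * T #|symdiff C B|) ^+ m / 2 ^+ n / 2 ^+ n).
  rewrite [RHS]exchange_big/= /mean_exp_residual_energy exchange_big/=.
  apply: eq_bigr => B _; rewrite -mulr_suml exchange_big/= mulr_suml.
  by apply: eq_bigr => C _; rewrite -prodE -mulr_suml.
(* For every [C] the sum over [B] yields the same [S]; the [2^n] choices of [C] then cancel one of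
   the two divisions by [2^n]. *)
transitivity (\sum_(C : {set 'I_n}) (2 ^+ n) ^+ m / 2 ^+ n / 2 ^+ n * S).
  apply: eq_bigr => C _.
  rewrite /S -(sum_symdiff (fun k => T k ^+ m) C) mulr_sumr.
  by apply: eq_bigr => B _; rewrite exprMn; ring.
have card_sets : #|{set 'I_n}| = (2 ^ n)%N.
  by rewrite -cardsT -powersetT card_powerset cardsT card_ord.
rewrite sumr_const card_ffun card_sets card_ord -[LHS]mulr_natl !natrX.
by field.
Qed.

End averaging.

(** * Choice of a good matrix and conversion to bits *)

Theorem proposition2 (R : realType) (m n : nat) (hm : (0 < m)%N) (hn : (0 < n)%N)
    (sigma : R) (hsigma : 0 < sigma) (gamma : R) (hgamma : 0 < gamma) :
  ((n%:R - m%:R * gamma * log2 (Num.sqrt (expR 1))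
    - log2 (\sum_(0 <= k < n.+1) 'C(n, k)%:R *
        (\sum_(0 <= j < k.+1) ('C(k, j)%:R / 2 ^+ k) *
           (expR (- 2 * ((2 * j%:R - k%:R) / (sigma * Num.sqrt m%:R)) ^+ 2 *
                  (gamma / (1 + gamma)))
            / Num.sqrt (1 + gamma))) ^+ m))%:E
   <= max_sum_capacity m n sigma)%E.
Proof.
set S := \sum_(0 <= k < n.+1) _.
have p0 : 0 < (2 ^+ n : R) by rewrite exprn_gt0.
(* With [d = 2 (2j - k) / sqrt m], the exponent contains [d^2 / (2 sigma^2) = 2 ((2j - k) / (sigma
   sqrt m))^2]. *)
have factorE (j k : nat) : gaussian_factor sigma gamma
      ((Num.sqrt m%:R)^-1 * (2 * (2 * j%:R - k%:R))) =
    expR (- 2 * ((2 * j%:R - k%:R) / (sigma * Num.sqrt m%:R)) ^+ 2 *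
      (gamma / (1 + gamma))) / Num.sqrt (1 + gamma).
  have q0 : 0 < Num.sqrt (m%:R : R) by rewrite sqrtr_gt0 ltr0n.
  rewrite /gaussian_factor; congr (expR _ / _).
  by field; rewrite !gt_eqF// ?addr_gt0.
(* The mean over all sign matrices is exactly [S / 2^n], so some matrix does not exceed it. *)
have [a WZ] : exists a,
    mean_exp_residual_energy sigma gamma (@sign_mx R m n a) <= S / 2 ^+ n.
  apply: (exists_le_of_sum_le [ffun=> finset.set0]).
  rewrite sum_mean_exp_residual_energy.
  rewrite le_eqVlt; apply/orP; left; apply/eqP; congr (_ * (_ / _)).
  apply: eq_bigr => k _; congr (_ * _ ^+ _); apply: eq_bigr => j _.
  by rewrite factorE.
have S0 : 0 < S.
  rewrite -(pmulr_lgt0 _ (_ : 0 < (2 ^+ n)^-1)) ?invr_gt0//.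
  exact: lt_le_trans (mean_exp_residual_energy_gt0 _ hgamma _) WZ.
have ln2 : ln (2 : R) != 0 by rewrite gt_eqF// ln_gt0// ltr1n.
have lnsqrte : ln (Num.sqrt (expR 1)) = 2^-1 :> R.
  rewrite (_ : expR 1 = expR 2^-1 ^+ 2); last first.
    by rewrite expr2 -expRD; congr expR; lra.
  by rewrite sqrtr_sqr ger0_norm ?expR_ge0// expRK.
(* The term [n] of the bound comes from [ln (S / 2^n) = ln S - n ln 2], and
   [log2 (sqrt e) = 1 / (2 ln 2)] accounts for the middle term. *)
rewrite (_ : _ - log2 S = (- (m%:R * (gamma / 2)) - ln (S / 2 ^+ n)) / ln 2).
  apply: le_trans (sum_capacity_ge hsigma hgamma WZ) _.
  by apply: ereal_sup_ubound; exists (sign_mx R a) => //; exact: pm1_sign_mx.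
rewrite /log2 lnsqrte ln_div ?posrE// lnXn// -[ln 2 *+ n]mulr_natl.
by field.
Qed.
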